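(* Let $r,m,n,q,p$ be positive integers, let $A_1,\dots,A_r\in\overline{\mathbb{R}}^{m\times n}$, $B_1,\dots,B_r\in\overline{\mathbb{R}}^{q\times p}$ and $C\in\overline{\mathbb{R}}^{m\times p}$. Then the matrix equation $$A_{1}\otimes X\otimes B_{1}\oplus A_{2}\otimes X\otimes B_{2}\oplus\cdots\oplus A_{r}\otimes X\otimes B_{r}=C$$ in the unknown $X\in\overline{\mathbb{R}}^{n\times q}$ is equivalent to the vector-matrix system $$\left(A_{1}\boxtimes B_{1}^{T}\oplus A_{2}\boxtimes B_{2}^{T}\oplus\cdots\oplus A_{r}\boxtimes B_{r}^{T}\right)\otimes \mathrm{vec}(X)=\mathrm{vec}(C),$$ that is, a matrix $X\in\overline{\mathbb{R}}^{n\times q}$ satisfies the first equation if and only if it satisfies the second.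
   Context: Operations are max-plus: $\overline{\mathbb{R}}=\mathbb{R}\cup\{\varepsilon\}$ with $\varepsilon=-\infty$, and for $a,b\in\overline{\mathbb{R}}$, $a\oplus b=\max(a,b)$, $a\otimes b=a+b$. For matrices of compatible sizes, $A\oplus B=(a_{ij}\oplus b_{ij})$, $A\otimes B=\left(\max_k (a_{ik}+b_{kj})\right)$, and for a scalar $\alpha$, $\alpha\otimes A=A\otimes\alpha=(\alpha\otimes a_{ij})$. The operation $\otimes$ (and $\boxtimes$) binds more strongly than $\oplus$. Tropical tensor product: for $A=(a_{ij})$ of size $m\times n$ and $B=(b_{ij})$ of size $r\times s$, $A\boxtimes B$ is the $mr\times ns$ block matrix with $r\times s$ blocks, whose $(i,j)$ block is the $m\times n$ matrix $A\otimes b_{ij}$ (note: the blocks are copies of the first factor $A$ scaled by the entries of the second factor $B$). $\mathrm{vec}(A)$ is the column vector formed by the first column of $A$, followed by the second column, and so on. $B^T$ is the transpose of $B$. *)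

(* Defs.v *)
From HB Require Import structures.
From mathcomp Require Import all_boot all_order all_algebra.
From mathcomp Require Import reals.

Set Implicit Arguments.
Unset Strict Implicit.
Unset Printing Implicit Defensive.

Import Order.TTheory GRing.Theory Num.Theory.

Local Open Scope ring_scope.

(* The max-plus semiring R ∪ {ε}: [Some x] is the finite element x and [None]
   is ε = -∞.  With the semiring structure below, the library notations [+],
   [*], [\sum], [*m] and [*:] at type [maxplus R] and on matrices over it are
   the max-plus ⊕, ⊗, iterated ⊕, matrix ⊗ and scalar ⊗; [0] is ε and [1] is
   the real number 0. *)
Definition maxplus (R : realDomainType) : Type := option R.

HB.instance Definition _ (R : realDomainType) := Choice.on (maxplus R).

Section MaxPlusSemiring.
Variable R : realDomainType.
Implicit Types x y z : maxplus R.

Definition mp_oplus x y : maxplus R :=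
  match x, y with
  | None, _ => y
  | _, None => x
  | Some a, Some b => Some (Num.max a b)
  end.

Definition mp_otimes x y : maxplus R :=
  match x, y with
  | Some a, Some b => Some (a + b)
  | _, _ => None
  end.

Fact mp_oplusA : associative mp_oplus.
Proof. by move=> [a|] [b|] [c|] //=; rewrite maxA. Qed.

Fact mp_oplusC : commutative mp_oplus.
Proof. by move=> [a|] [b|] //=; rewrite maxC. Qed.

Fact mp_oplus0x : left_id None mp_oplus.
Proof. by case. Qed.

HB.instance Definition _ :=
  GRing.isNmodule.Build (maxplus R) mp_oplusA mp_oplusC mp_oplus0x.

Fact mp_otimesA : associative mp_otimes.
Proof. by move=> [a|] [b|] [c|] //=; rewrite addrA. Qed.

Fact mp_otimesC : commutative mp_otimes.
Proof. by move=> [a|] [b|] //=; rewrite addrC. Qed.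

Fact mp_otimes1x : left_id (Some 0) mp_otimes.
Proof. by case=> [a|] //=; rewrite add0r. Qed.

Fact mp_otimesDl : left_distributive mp_otimes mp_oplus.
Proof. by move=> [a|] [b|] [c|] //=; rewrite addr_maxl. Qed.

Fact mp_otimes0x : left_zero None mp_otimes.
Proof. by []. Qed.

Fact mp_one_neq0 : Some 0 != None :> maxplus R.
Proof. by []. Qed.

HB.instance Definition _ := GRing.Nmodule_isComNzSemiRing.Build (maxplus R)
  mp_otimesA mp_otimesC mp_otimes1x mp_otimesDl mp_otimes0x mp_one_neq0.

End MaxPlusSemiring.

(* The blocks are copies of the first factor, scaled by the entries of the
   second one (the opposite of the usual Kronecker convention).  The dimensions
   [\sum_(i < r) m] and [\sum_(j < s) n] that [\mxblock] produces are r m and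
   s n. *)
Definition boxtimes (R : realDomainType) (m n r s : nat)
    (A : 'M[maxplus R]_(m, n)) (B : 'M[maxplus R]_(r, s)) :
    'M[maxplus R]_(\sum_(i < r) m, \sum_(j < s) n) :=
  \mxblock_(i < r, j < s) (B i j *: A).

Definition vec (T : Type) (m n : nat) (A : 'M[T]_(m, n)) :
    'cV[T]_(\sum_(j < n) m) :=
  \mxcol_(j < n) col j A.

(* Main.v *)
(* Column i of (A X B) is \sum_j b_ji A (col j X), which is block i of
   (A ⊠ B^T) vec X; hence vec (A X B) = (A ⊠ B^T) vec X, and the equivalence
   follows since vec is additive and injective. *)
Require Import Defs.
From mathcomp Require Import all_boot all_order all_algebra.
From mathcomp Require Import reals.

Local Open Scope ring_scope.

(** Only commutative semiring laws enter, never the order. By [boxtimes_vec] for each term and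
    additivity of [vec] ([vec_sum]), the left side of the system is [vec] of the left side of the
    equation; [vec_inj] then cancels [vec]. *)

Lemma vec_inj (T : Type) (m n : nat) : injective (@vec T m n).
Proof.
rewrite /vec => A B /eq_mxcolP colAB; apply/matrixP => i j.
by have /colP/(_ i) := colAB j; rewrite !mxE.
Qed.

Lemma vec_sum (V : nmodType) (m n : nat) (I : Type) (s : seq I) (P : pred I)
    (F : I -> 'M[V]_(m, n)) :
  vec (\sum_(i <- s | P i) F i) = \sum_(i <- s | P i) vec (F i).
Proof.
by apply: (big_morph (@vec V m n)) => [A B|]; apply/colP => i; rewrite !mxE.
Qed.

Lemma boxtimes_vec (R : realDomainType) (m n q p : nat)
    (A : 'M[maxplus R]_(m, n)) (B : 'M[maxplus R]_(q, p))
    (X : 'M[maxplus R]_(n, q)) :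
  boxtimes A B^T *m vec X = vec (A *m X *m B).
Proof.
rewrite /boxtimes /vec mul_mxblock_mxrow; apply/eq_mxcolP => j.
apply/colP => i; rewrite summxE !mxE; apply: eq_bigr => k _.
(* The scalar [B k j] multiplies the block on the left but [A *m X] on the right, so commutativity
   of ⊗ is essential. *)
rewrite -scalemxAl !mxE GRing.mulrC; congr (_ * _).
by apply: eq_bigr => l _; rewrite mxE.
Qed.

Theorem theorem7 (R : realType) (r m n q p : nat)
  (hr : (0 < r)%N) (hm : (0 < m)%N) (hn : (0 < n)%N)
  (hq : (0 < q)%N) (hp : (0 < p)%N)
  (A : 'I_r -> 'M[maxplus R]_(m, n))
  (B : 'I_r -> 'M[maxplus R]_(q, p))
  (C : 'M[maxplus R]_(m, p))
  (X : 'M[maxplus R]_(n, q)) :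
  \sum_(k < r) A k *m X *m B k = C <->
  (\sum_(k < r) boxtimes (A k) (B k)^T) *m vec X = vec C.
Proof.
have -> : (\sum_(k < r) boxtimes (A k) (B k)^T) *m vec X
          = vec (\sum_(k < r) A k *m X *m B k).
  by rewrite mulmx_suml vec_sum; apply: eq_bigr => k _; exact: boxtimes_vec.
(* Injectivity serves only the way back from the system. *)
by split=> [->|/vec_inj].
Qed.
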